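(* Let $G$ be a commutative multiplicative hyperring with identity $1$ and let $S$ be a multiplicative closed subset of $G$. Let $A_1,\ldots,A_k$ be quasi $S$-primary $\mathcal{C}$-hyperideals of $G$ and let $A$ be a hyperideal of $G$. If $A\subseteq\bigcup_{i=1}^k A_i$, then there exists $t\in S$ such that $t\circ A\subseteq\mathrm{rad}(A_j)$ for some $1\le j\le k$.
   Context: A commutative multiplicative hyperring with identity is a triple $(G,+,\circ)$ where $(G,+)$ is an abelian group and $\circ$ assigns to each pair $(x,y)\in G\times G$ a non-empty subset $x\circ y\subseteq G$, such that for all $x,y,z\in G$: $(x\circ y)\circ z=x\circ(y\circ z)$; $(-x)\circ y=x\circ(-y)=-(x\circ y)$; $(y+z)\circ x\subseteq y\circ x+z\circ x$ and $x\circ(y+z)\subseteq x\circ y+x\circ z$; $x\circ y=y\circ x$; and there is $1\in G$ with $a\in 1\circ a$ for all $a\in G$. For non-empty subsets $X,Y\subseteq G$, $X\circ Y=\bigcup_{x\in X,y\in Y}x\circ y$ and $X+Y=\{x+y: x\in X,y\in Y\}$; elements are identified with singletons. A hyperideal of $G$ is a non-empty $A\subseteq G$ with $x-y\in A$ for all $x,y\in A$ and $r\circ x\subseteq A$ for all $x\in A$, $r\in G$. A proper hyperideal $P$ is prime if $x\circ y\subseteq P$ ($x,y\in G$) implies $x\in P$ or $y\in P$. $\mathrm{rad}(A)$ is the intersection of all prime hyperideals containing $A$, and $\mathrm{rad}(A)=G$ if there are none. $A$ is a $\mathcal{C}$-hyperideal if for all $n\in\mathbb{N}$ and $a_1,\dots,a_n\in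 G$, $(a_1\circ\cdots\circ a_n)\cap A\neq\varnothing$ implies $a_1\circ\cdots\circ a_n\subseteq A$. A multiplicative closed subset (MCS) of $G$ is a subset $S\subseteq G$ containing $1$ with $(s_1\circ s_2)\cap S\neq\varnothing$ for all $s_1,s_2\in S$. A hyperideal $A$ with $A\cap S=\varnothing$ is quasi $S$-primary if there is $t\in S$ such that for all $u,v\in G$, $u\circ v\subseteq A$ implies $t\circ u\subseteq \mathrm{rad}(A)$ or $t\circ v\subseteq\mathrm{rad}(A)$. *)

(* Defs.v *)
From HB Require Import structures.
From mathcomp Require Import all_boot all_algebra.
From mathcomp Require Import classical_sets.

Set Implicit Arguments.
Unset Strict Implicit.
Unset Printing Implicit Defensive.

Import GRing.Theory.

Local Open Scope ring_scope.
Local Open Scope classical_set_scope.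

Definition lift_hop (T : Type) (op : T -> T -> set T) (X Y : set T) : set T :=
  \bigcup_(x in X) \bigcup_(y in Y) op x y.

(* Distributivity is only an inclusion, and the identity need not be unique:
   hone is a chosen one, with a \in 1 o a instead of 1 o a = {a}. *)
HB.mixin Record Zmodule_isComHyperring G of GRing.Zmodule G := {
  hone : G;
  hmul : G -> G -> set G;
  hmul_nonempty : forall x y, hmul x y !=set0;
  hmulA : forall x y z,
    lift_hop hmul (hmul x y) [set z] = lift_hop hmul [set x] (hmul y z);
  hmulNl : forall x y, hmul (- x) y = [set - z | z in hmul x y];
  hmulNr : forall x y, hmul x (- y) = [set - z | z in hmul x y];
  hmulDl : forall x y z,
    hmul (y + z) x `<=` [set a + b | a in hmul y x & b in hmul z x];
  hmulDr : forall x y z,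
    hmul x (y + z) `<=` [set a + b | a in hmul x y & b in hmul x z];
  hmulC : forall x y, hmul x y = hmul y x;
  hmul1 : forall a, hmul hone a a
}.

#[short(type="comHyperringType")]
HB.structure Definition ComHyperring :=
  { G of GRing.Zmodule G & Zmodule_isComHyperring G }.

Definition hmul_set (G : comHyperringType) (X Y : set G) : set G :=
  lift_hop hmul X Y.

Declare Scope hyperring_scope.
Delimit Scope hyperring_scope with H.
Notation "x ** y" := (hmul x y) (at level 40, left associativity)
  : hyperring_scope.
Notation "X *** Y" := (hmul_set X Y) (at level 40, left associativity)
  : hyperring_scope.
Local Open Scope hyperring_scope.

Record hyperideal (G : comHyperringType) (A : set G) : Prop := Hyperideal {
  hyperideal_nonempty : A !=set0;
  hyperidealB : forall x y, A x -> A y -> A (x - y);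
  hyperidealM : forall r x, A x -> r ** x `<=` A
}.

Record prime_hyperideal (G : comHyperringType) (P : set G) : Prop :=
  PrimeHyperideal {
    prime_is_hyperideal : hyperideal P;
    prime_proper : P <> setT;
    primeM : forall x y, x ** y `<=` P -> P x \/ P y
  }.

(* An intersection over the empty family is setT, so hrad A = setT when no
   prime hyperideal contains A. *)
Definition hrad (G : comHyperringType) (A : set G) : set G :=
  \bigcap_(P in [set P : set G | prime_hyperideal P /\ A `<=` P]) P.

(* hprod a s is the product a o s_1 o ... o s_m; a nonempty list of factors is
   given as its head and tail since there is no canonical empty product. *)
Definition hprod (G : comHyperringType) (a : G) (s : seq G) : set G :=
  foldl (fun X y => X *** [set y]) [set a] s.

Record C_hyperideal (G : comHyperringType) (A : set G) : Prop := CHyperideal {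
  C_is_hyperideal : hyperideal A;
  C_closed : forall a s, hprod a s `&` A !=set0 -> hprod a s `<=` A
}.

Record mult_closed (G : comHyperringType) (S : set G) : Prop := MultClosed {
  mult_closed1 : S hone;
  mult_closedM : forall s1 s2, S s1 -> S s2 -> (s1 ** s2) `&` S !=set0
}.

(* The multiplier t does not depend on u and v. *)
Record quasi_S_primary (G : comHyperringType) (S A : set G) : Prop :=
  QuasiSPrimary {
    qSp_hyperideal : hyperideal A;
    qSp_disjoint : A `&` S = set0;
    qSp_mult : exists2 t, S t & forall u v, u ** v `<=` A ->
      t ** u `<=` hrad A \/ t ** v `<=` hrad A
  }.

(* Main.v *)
Require Import Defs.
From mathcomp Require Import all_boot all_algebra.
From mathcomp Require Import boolp classical_sets.

(** Let [R] be the radical of one of the [As i] and [t] its multiplier. The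
colon [(R : t)], the set of the [x] with [t o x] inside [R], is a prime
hyperideal containing [As i]; hence [A] is covered by finitely many prime
hyperideals, prime avoidance ([prime_avoidance]) places it inside one of
these colons, and this is the conclusion.

That the colon is prime is an argument with powers. An element of [R] has a
power meeting [As i] ([hrad_hexp_meets], by Zorn's lemma). So when a product
[X] of finitely many elements meets [R], some power of [X] meets [As i]; this
power is again a product of elements, and the C-property puts all of it
inside [As i] ([hrad_hprod]). Three consequences follow. [R] is itself a
C-hyperideal ([hrad_C]). The multiplier also works for pairs with [u o v] in
[R] instead of [As i] ([qSp_hrad]). Finally [R] is disjoint from [S]
([qSp_hrad_disjoint]), which makes it possible to remove from a product in
[R] the second factor [t] that the multiplier introduces when it is applied
to [t o x o y] ([colon_hrad_prime]). *)

Import GRing.Theory.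

Local Open Scope ring_scope.
Local Open Scope classical_set_scope.
Local Open Scope hyperring_scope.

(** * Products of subsets *)

Section SetProducts.
Context {G : comHyperringType}.
Implicit Types (X Y Z : set G) (x y z : G).

Lemma hmul_setP X Y z :
  (X *** Y) z <-> exists x y, [/\ X x, Y y & (x ** y) z].
Proof.
split=> [[x Xx [y Yy zxy]]|[x [y [Xx Yy zxy]]]]; first by exists x, y.
by exists x => //; exists y.
Qed.

Lemma mem_hmul_set X Y x y : X x -> Y y -> x ** y `<=` X *** Y.
Proof. by move=> Xx Yy z zxy; apply/hmul_setP; exists x, y. Qed.

Lemma hmul_set11 x y : [set x] *** [set y] = x ** y.
Proof.
apply/seteqP; split=> z; first by case/hmul_setP=> a [b [-> ->]].
exact: mem_hmul_set.
Qed.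

Lemma hmul_setC X Y : X *** Y = Y *** X.
Proof.
by apply/seteqP; split=> z /hmul_setP [x [y [Xx Yy]]]; rewrite hmulC => zxy;
  apply/hmul_setP; exists y, x.
Qed.

Lemma hmul_setA X Y Z : X *** (Y *** Z) = X *** Y *** Z.
Proof.
apply/seteqP; split=> w /hmul_setP.
  move=> [x [v [Xx /hmul_setP [y [z [Yy Zz vyz]]] wxv]]].
  have /hmul_setP [u [_ [uxy -> wuz]]] : ((x ** y) *** [set z]) w.
    by rewrite /hmul_set hmulA; apply/hmul_setP; exists x, v.
  by apply/hmul_setP; exists u, z; split=> //; apply: mem_hmul_set uxy.
move=> [u [z [/hmul_setP [x [y [Xx Yy uxy]]] Zz wuz]]].
have /hmul_setP [_ [v [-> vyz wxv]]] : ([set x] *** (y ** z)) w.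
  by rewrite /hmul_set -hmulA; apply/hmul_setP; exists u, z.
by apply/hmul_setP; exists x, v; split=> //; apply: mem_hmul_set vyz.
Qed.

Lemma hmul_setACA X Y Z W : (X *** Y) *** (Z *** W) = (X *** Z) *** (Y *** W).
Proof.
by rewrite -!hmul_setA; congr (_ *** _); rewrite !hmul_setA (hmul_setC Y).
Qed.

Lemma hmul_setS X Y Z W : X `<=` Y -> Z `<=` W -> X *** Z `<=` Y *** W.
Proof.
move=> XY ZW w /hmul_setP [x [z [/XY Yx /ZW Wz wxz]]].
exact: mem_hmul_set wxz.
Qed.

Lemma hmul_set_neq0 X Y : X !=set0 -> Y !=set0 -> X *** Y !=set0.
Proof.
move=> [x Xx] [y Yy]; have [z zxy] := hmul_nonempty x y.
by exists z; apply: mem_hmul_set zxy.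
Qed.

(** The exponent is shifted, [hexp X n] being [X o ... o X] with [n.+1]
factors, because in general no subset is neutral for the product. *)
Definition hexp X n : set G := iter n (hmul_set X) X.

Lemma hexpS X n : hexp X n.+1 = X *** hexp X n. Proof. by []. Qed.

Lemma hexpD X m n : hexp X m *** hexp X n = hexp X (m + n).+1.
Proof. by elim: m => [//|m IHm]; rewrite hexpS -hmul_setA IHm. Qed.

Lemma hexpM X Y n : hexp (X *** Y) n = hexp X n *** hexp Y n.
Proof. by elim: n => [//|n IHn]; rewrite !hexpS IHn hmul_setACA. Qed.

Lemma hexp_sub X Y n : X `<=` Y -> hexp X n `<=` hexp Y n.
Proof. by move=> XY; elim: n => [//|n IHn]; apply: hmul_setS. Qed.

Lemma hexp_neq0 X n : X !=set0 -> hexp X n !=set0.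
Proof. by move=> X0; elim: n => [//|n IHn]; apply: hmul_set_neq0. Qed.

(** The sets to which the C-property applies. They are closed under products,
so that no list of factors needs to be mentioned afterwards. *)
Definition is_hprod X := exists a s, X = hprod a s.

Lemma is_hprod1 x : is_hprod [set x].
Proof. by exists x, [::]. Qed.

Lemma hprod_cat (a b : G) (s r : seq G) :
  hprod a (s ++ b :: r) = hprod a s *** hprod b r.
Proof.
elim/last_ind: r => [|r c IHr]; first by rewrite /hprod foldl_cat.
rewrite -rcons_cons -rcons_cat /hprod !foldl_rcons -!/(hprod _ _).
by rewrite IHr hmul_setA.
Qed.

Lemma is_hprodM X Y : is_hprod X -> is_hprod Y -> is_hprod (X *** Y).
Proof.
move=> [a [s ->]] [b [r ->]].
by exists a, (s ++ b :: r); rewrite hprod_cat.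
Qed.

Lemma is_hprod_hexp X n : is_hprod X -> is_hprod (hexp X n).
Proof. by move=> pX; elim: n => [//|n IHn]; apply: is_hprodM. Qed.

End SetProducts.

(** * Hyperideals, colons and radicals *)

Section Hyperideals.
Context {G : comHyperringType}.
Implicit Types (A P T X Y : set G) (a r t x y : G).

Lemma hyperideal0 A : hyperideal A -> A 0.
Proof.
move=> hA; have [x Ax] := hyperideal_nonempty hA.
by rewrite -(subrr x); apply: hyperidealB.
Qed.

Lemma hyperidealN A x : hyperideal A -> A x -> A (- x).
Proof.
move=> hA Ax; rewrite -sub0r.
by apply: hyperidealB => //; apply: hyperideal0.
Qed.

Lemma hyperidealD A x y : hyperideal A -> A x -> A y -> A (x + y).
Proof.
move=> hA Ax Ay; rewrite -[y]opprK.
by apply: hyperidealB => //; apply: hyperidealN.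
Qed.

Lemma hyperideal_hmul_set A X Y : hyperideal A -> X `<=` A -> Y *** X `<=` A.
Proof.
move=> hA XA z /hmul_setP [y [x [_ /XA Ax zyx]]].
exact: (hyperidealM hA) zyx.
Qed.

Lemma C_sub A X : C_hyperideal A -> is_hprod X -> X `&` A !=set0 -> X `<=` A.
Proof. by move=> hA [a [s ->]]; apply: C_closed. Qed.

Definition colon A t : set G := [set x | t ** x `<=` A].

Lemma sub_colon A t : hyperideal A -> A `<=` colon A t.
Proof. by move=> hA x Ax; apply: hyperidealM. Qed.

Lemma colon_hyperideal A t : hyperideal A -> hyperideal (colon A t).
Proof.
move=> hA; split.
- by exists 0; apply: sub_colon => //; apply: hyperideal0.
- move=> x y tx ty z /hmulDr [a /tx Aa [b]].
  rewrite hmulNr => -[c /ty Ac <-] <-.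
  exact: hyperidealB.
- move=> r x tx y yrx z zty.
  have : ([set t] *** (r ** x)) z by apply: mem_hmul_set zty.
  rewrite -hmul_set11 hmul_setA [[set t] *** _]hmul_setC -hmul_setA hmul_set11.
  exact: hyperideal_hmul_set.
Qed.

Lemma hrad_hyperideal A : hyperideal (hrad A).
Proof.
split.
- by exists 0 => P [[hP _ _] _]; apply: hyperideal0.
- move=> x y rx ry P AP; have [[hP _ _] _] := AP.
  by apply: hyperidealB; [|apply: rx|apply: ry].
- move=> r x rx y yrx P AP; have [[hP _ _] _] := AP.
  by apply: (hyperidealM hP) yrx; apply: rx.
Qed.

Lemma prime_hexp P x n : prime_hyperideal P -> hexp [set x] n `<=` P -> P x.
Proof.
move=> pP; elim: n => [|n IHn]; first by apply.
move=> xnP; have [//|Px] := EM (P x); apply: IHn => y xny.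
have [z zxy|//|//] := primeM pP (x := x) (y := y).
by apply: xnP; apply: mem_hmul_set zxy.
Qed.

Lemma hrad_hexp A X n : hexp X n `<=` hrad A -> X `<=` hrad A.
Proof.
move=> XnA x Xx P AP; have [pP _] := AP; apply: (@prime_hexp _ _ n) => //.
have xX : [set x] `<=` X by move=> _ ->.
by move=> y /(@hexp_sub _ _ _ n xX)/XnA; apply.
Qed.

(** Krull's lemma, with [T] multiplicative only in the sense that products
meet [T]. The primeness of a maximal element [P] disjoint from [T] uses
colons, since hyperideals generated by an element are awkward when
distributivity is only an inclusion: if [x o y] is in [P] with [x] and [y]
outside, then [(P : y)] is larger than [P] and so contains some [s] in [T],
whence [(P : s)] contains [y] and so some [t] in [T]; but then [s o t] is in
[P] and meets [T]. Disjointness, unlike the weaker requirement that no power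
of a given element is contained in the hyperideal, is preserved by unions of
chains. *)
Lemma ex_prime_disjoint A T :
  hyperideal A -> T !=set0 ->
  (forall s t, T s -> T t -> (s ** t) `&` T !=set0) ->
  A `&` T = set0 ->
  exists P, [/\ prime_hyperideal P, A `<=` P & P `&` T = set0].
Proof.
move=> hA [t0 Tt0] TM AT.
(* Adjoining A makes the family stable under the union of the empty chain. *)
pose F : set (set G) :=
  [set X | hyperideal (A `|` X) /\ (A `|` X) `&` T = set0].
have [C CF Ctot|X [[hX XT] Xmax]] := @Zorn_bigcup G F.
  have up X x y : C X -> (A `|` \bigcup_(Y in C) Y) x -> (A `|` X) y ->
      exists2 Y, C Y & (A `|` Y) x /\ (A `|` Y) y.
    move=> CX [Ax|[Y CY Yx]] Xy; first by exists X => //; split => //; left.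
    have [XY|YX] := Ctot _ _ CX CY.
      by exists Y => //; split; [right|case: Xy => [|/XY]; [left|right]].
    by exists X => //; split => //; right; apply: YX.
  have sub Y : C Y -> A `|` Y `<=` A `|` \bigcup_(Z in C) Z.
    by move=> CY x [Ax|Yx]; [left|right; exists Y].
  split; last first.
    rewrite -subset0 => x [[Ax|[Y CY Yx]] Tx].
      by have : (A `&` T) x by []; rewrite AT.
    have [_ YT] := CF _ CY.
    by have : ((A `|` Y) `&` T) x; [split=> //; right|rewrite YT].
  split.
  - by have [a Aa] := hyperideal_nonempty hA; exists a; left.
  - move=> x y Ux [Ay|[X CX Xy]].
      case: Ux => [Ax|[X CX Xx]]; first by left; apply: hyperidealB.
      have [hX _] := CF _ CX; apply: (sub _ CX).
      by apply: hyperidealB => //; [right|left].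
    have [|Y CY [Yx Yy]] := up X x y CX Ux; first by right.
    by have [hY _] := CF _ CY; apply: (sub _ CY); apply: hyperidealB.
  - move=> r x [Ax|[X CX Xx]] y yrx; first by left; apply: (hyperidealM hA) yrx.
    have [hX _] := CF _ CX; apply: (sub _ CX); apply: (hyperidealM hX) yrx.
    by right.
set P := A `|` X in hX XT.
have meet Q x : hyperideal Q -> P `<=` Q -> Q x -> ~ P x ->
    exists2 t, Q t & T t.
  move=> hQ PQ Qx nPx; apply: contrapT => nQT.
  have AQ : A `|` Q = Q.
    by apply/seteqP; split=> [y [Ay|//]|y Qy]; [apply: PQ; left|right].
  apply: (Xmax Q); last first.
    split; rewrite AQ // -subset0 => y [Qy Ty].
    by apply: nQT; exists y.
  split; first by move=> y Xy; apply: PQ; right.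
  by move=> QX; apply: nPx; right; apply: QX.
have disj x : P x -> T x -> False.
  by move=> Px Tx; have : (P `&` T) x by []; rewrite XT.
exists P; split=> //; last by move=> x Ax; left.
split=> //; first by move=> PT; apply: (disj t0) => //; rewrite PT.
move=> x y xyP; apply: contrapT => /not_orP [nPx nPy].
have [||||s ys Ts] := @meet (colon P y) x => //.
- exact: colon_hyperideal.
- exact: sub_colon.
- by rewrite /colon /= hmulC.
have [||||t st Tt] := @meet (colon P s) y => //.
- exact: colon_hyperideal.
- exact: sub_colon.
- by rewrite /colon /= hmulC.
by have [z [/st Pz Tz]] := TM _ _ Ts Tt; apply: disj Pz Tz.
Qed.

Lemma hrad_hexp_meets A x :
  hyperideal A -> hrad A x -> exists n, hexp [set x] n `&` A !=set0.
Proof.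
move=> hA rx; apply: contrapT => nxA.
pose T := \bigcup_n hexp [set x] n.
have Tx : T x by exists 0%N.
have [||||P [pP AP PT]] := @ex_prime_disjoint A T => //.
- by exists x.
- move=> s t [m _ xms] [n _ xnt]; have [z zst] := hmul_nonempty s t.
  exists z; split=> //; exists (m + n).+1 => //.
  by rewrite -hexpD; apply: mem_hmul_set zst.
- rewrite -subset0 => y [Ay [n _ xny]].
  by apply: nxA; exists n, y.
by have : (P `&` T) x; [split=> //; apply: rx|rewrite PT].
Qed.

(** Since [X] is a product, so are its powers, and they lie in [A] as soon as
they meet it. *)
Lemma hrad_hprod A X :
  C_hyperideal A -> is_hprod X -> X `&` hrad A !=set0 ->
  exists n, hexp X n `<=` A.
Proof.
move=> hA pX [x [Xx rx]].
have [n [y [xny Ay]]] := hrad_hexp_meets _ _ (C_is_hyperideal hA) rx.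
exists n; apply: C_sub => //; first exact: is_hprod_hexp.
by exists y; split=> //; apply: hexp_sub xny => _ ->.
Qed.

Lemma sub_hrad A : A `<=` hrad A.
Proof. by move=> x Ax P [_ AP]; apply: AP. Qed.

Lemma hrad_C A X :
  C_hyperideal A -> is_hprod X -> X `&` hrad A !=set0 -> X `<=` hrad A.
Proof.
move=> hA pX /(hrad_hprod _ _ hA pX) [n XnA]; apply: (hrad_hexp _ _ n).
exact: subset_trans XnA (@sub_hrad A).
Qed.

End Hyperideals.

(** * Radicals of quasi S-primary C-hyperideals *)

Section QuasiSPrimary.
Context {G : comHyperringType} {S A : set G}.
Hypotheses (hS : mult_closed S) (hC : C_hyperideal A).

Lemma mult_closed_hexp s n : S s -> hexp [set s] n `&` S !=set0.
Proof.
move=> Ss; elim: n => [|n [y [sny Sy]]]; first by exists s.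
have [z [zsy Sz]] := mult_closedM hS Ss Sy.
by exists z; split=> //; apply: mem_hmul_set zsy.
Qed.

Lemma qSp_hrad_disjoint s : A `&` S = set0 -> hrad A s -> S s -> False.
Proof.
move=> AS rs Ss.
have [|n snA] := hrad_hprod _ _ hC (is_hprod1 s); first by exists s.
have [y [/snA Ay Sy]] := mult_closed_hexp s n Ss.
by have : (A `&` S) y by []; rewrite AS.
Qed.

(** An exponent can be dropped because the radical contains [t o u] as soon as
it contains a power of it, and such a power is a multiple of the product of
[t] with a power of [u]. *)
Lemma hexp_cancel t u n :
  ([set t] *** hexp [set u] n) `&` hrad A !=set0 -> t ** u `<=` hrad A.
Proof.
move=> tunR; have : [set t] *** hexp [set u] n `<=` hrad A.
  apply: hrad_C => //; apply: is_hprodM; first exact: is_hprod1.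
  by apply: is_hprod_hexp; apply: is_hprod1.
move=> {}tunR; rewrite -hmul_set11; apply: (hrad_hexp _ _ n).
rewrite hexpM; case: n tunR => [//|n] tunR.
(* The power of t still needed is supplied by the absorption property. *)
rewrite hexpS [[set t] *** hexp _ n]hmul_setC -hmul_setA.
exact: hyperideal_hmul_set (@hrad_hyperideal _ A) tunR.
Qed.

(** A power of [u o v] lies in [A]; so does the product of an element of a
power of [u] and an element of the same power of [v], and the multiplier can
be applied to these. *)
Lemma qSp_hrad t u v :
  (forall x y, x ** y `<=` A -> t ** x `<=` hrad A \/ t ** y `<=` hrad A) ->
  u ** v `<=` hrad A -> t ** u `<=` hrad A \/ t ** v `<=` hrad A.
Proof.
move=> ht uvR.
have [||n] := hrad_hprod _ ([set u] *** [set v]) hC.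
- by apply: is_hprodM; apply: is_hprod1.
- have [w uvw] := hmul_nonempty u v; rewrite hmul_set11.
  by exists w; split; last exact: uvR.
rewrite hexpM => uvnA.
have pow1 (w : G) : hexp [set w] n !=set0 by apply: hexp_neq0; exists w.
have [[a una] [b vnb]] := (pow1 u, pow1 v).
have meets w c : hexp [set w] n c -> t ** c `<=` hrad A -> t ** w `<=` hrad A.
  move=> wnc tcR; apply: (hexp_cancel t w n); have [z ztc] := hmul_nonempty t c.
  by exists z; split; [apply: mem_hmul_set ztc|apply: tcR].
have [|taR|tbR] := ht a b.
- by move=> z zab; apply: uvnA; apply: mem_hmul_set zab.
- by left; apply: meets taR.
- by right; apply: meets tbR.
Qed.

(** If [t o x o y] is in the radical then either [t o y] is, or [t o z] is for
every [z] in [t o x]. In the latter case an element [s] of [S] in [t o t]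
satisfies [s o x `<=` hrad A]; as [t o s] meets [S] it is not inside the
radical, so [t o x] is. *)
Lemma colon_hrad_prime t :
  A `&` S = set0 -> S t ->
  (forall x y, x ** y `<=` A -> t ** x `<=` hrad A \/ t ** y `<=` hrad A) ->
  prime_hyperideal (colon (hrad A) t).
Proof.
move=> AS St ht; split.
- exact: colon_hyperideal (hrad_hyperideal A).
- move=> RT; apply: (qSp_hrad_disjoint t AS) => //.
  have : colon (hrad A) t hone by rewrite RT.
  by apply; rewrite hmulC; apply: hmul1.
move=> x y xyR; apply: contrapT => /not_orP [nx ny]; apply: nx.
have ttxR : [set t] *** (t ** x) `<=` hrad A.
  move=> w /hmul_setP [_ [z [-> ztx wtz]]].
  have [v vzy||] := qSp_hrad t z y ht; [|by apply|by move/ny].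
  have /hmul_setP [_ [u [-> xyu vtu]]] : ([set t] *** (x ** y)) v.
    rewrite -hmul_set11 hmul_setA hmul_set11.
    by apply: mem_hmul_set vzy.
  exact: xyR vtu.
have [s [stt Ss]] := mult_closedM hS St St.
have [v vsx|tsR|] := qSp_hrad t s x ht; last by [].
  apply: ttxR; rewrite -hmul_set11 hmul_setA hmul_set11.
  by apply: mem_hmul_set vsx.
have [v [/tsR rv Sv]] := mult_closedM hS St Ss.
by have := qSp_hrad_disjoint v AS rv Sv.
Qed.

End QuasiSPrimary.

(** * Prime avoidance *)

Section Avoidance.
Context {G : comHyperringType}.
Implicit Types A Q : set G.

(** Products of elements outside [Q], taken one factor at a time: primeness
only says that some element of each product stays outside [Q], and this is
the one to multiply further. *)
Lemma ex_common_element A Q (I : eqType) (P : I -> set G) (s : seq I) :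
  prime_hyperideal Q -> hyperideal A -> (forall i, hyperideal (P i)) ->
  ~ A `<=` Q -> (forall i, i \in s -> ~ P i `<=` Q) ->
  exists w, [/\ A w, ~ Q w & forall i, i \in s -> P i w].
Proof.
move=> pQ hA hP nAQ; elim: s => [|i s IHs] nPQ.
  by have /existsNP [w /not_implyP [Aw nQw]] := nAQ; exists w.
have [|w [Aw nQw Pw]] := IHs.
  by move=> j js; apply: nPQ; rewrite in_cons js orbT.
have /existsNP [y /not_implyP [Py nQy]] := nPQ i (mem_head i s).
have /existsNP [z /not_implyP [zyw nQz]] : ~ y ** w `<=` Q.
  by move=> /(primeM pQ) [].
exists z; split=> //.
- exact: (hyperidealM hA) zyw.
- move=> j; rewrite in_cons => /predU1P [->|/Pw Pjw].
    by move: zyw; rewrite hmulC => zwy; apply: (hyperidealM (hP i)) zwy.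
  exact: (hyperidealM (hP j)) zyw.
Qed.

(** Take a minimal subfamily [D] covering [A] and [i] in it: no other member is
contained in [P i], and some [x] in [A] is only covered by [P i]. Unless [A]
is inside [P i], some [w] in [A] lies in all the other members but not in
[P i], and [x + w] is not covered. *)
Lemma prime_avoidance A (I : finType) (P : I -> set G) :
  hyperideal A -> (forall i, prime_hyperideal (P i)) ->
  A `<=` \bigcup_i P i -> exists i, A `<=` P i.
Proof.
move=> hA pP AP; have hP i := prime_is_hyperideal (pP i).
pose covers (D : {set I}) := `[< forall x, A x -> exists2 i, i \in D & P i x >].
have covT : covers [set: I]%SET.
  by apply/asboolP => x /AP [i _ Pix]; exists i.
have [D /minsetP [/asboolP covD minD] _] := minset_exists covT.
have noncov i : i \in D ->
    exists2 x, A x & forall j, j \in D -> j != i -> ~ P j x.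
  move=> iD; apply: contrapT => nx.
  have /minD : covers (D :\ i)%SET.
    apply/asboolP => x Ax; apply: contrapT => nj.
    apply: nx; exists x => // j jD ji Pjx.
    by apply: nj; exists j => //; rewrite in_setD1 ji.
  move=> /(_ (subD1set _ _)) DE; move: iD.
  by rewrite -DE in_setD1 eqxx.
have [i iD _] := covD 0 (hyperideal0 _ hA).
exists i; apply: contrapT => nAPi.
have [x Ax nPx] := noncov i iD.
have [|w [Aw nPw Pw]] :=
    ex_common_element A (P i) I P (enum (D :\ i)%SET) (pP i) hA hP nAPi.
  move=> j; rewrite mem_enum in_setD1 => /andP [ji jD] PjPi.
  have [y Ay nPy] := noncov j jD; have [l lD Ply] := covD y Ay.
  have lj : l = j by apply/eqP; apply: contrapT => /negP lj; apply: (nPy l).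
  by apply: (nPy i) => //; [rewrite eq_sym|apply: PjPi; rewrite -lj].
have [l lD Plx] := covD x Ax.
have li : l = i by apply/eqP; apply: contrapT => /negP li; apply: (nPx l).
rewrite {l lD}li in Plx.
have [j jD Pj] := covD _ (hyperidealD _ _ _ hA Ax Aw).
have [ji|ji] := eqVneq j i.
  apply: nPw; rewrite -(addKr x w) addrC.
  by apply: hyperidealB => //; rewrite -ji.
apply: (nPx j) => //; rewrite -(addrK w x).
by apply: hyperidealB => //; apply: Pw; rewrite mem_enum in_setD1 ji.
Qed.

End Avoidance.

Theorem theorem2p11 (G : comHyperringType) (S : set G) (hS : mult_closed S)
    (k : nat) (As : 'I_k -> set G)
    (hq : forall i, quasi_S_primary S (As i))
    (hC : forall i, C_hyperideal (As i))
    (A : set G) (hA : hyperideal A)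
    (hcover : A `<=` \bigcup_i As i) :
  exists2 t, S t & exists j : 'I_k, [set t] *** A `<=` hrad (As j).
Proof.
have mult i : exists t, S t /\ forall u v, u ** v `<=` As i ->
    t ** u `<=` hrad (As i) \/ t ** v `<=` hrad (As i).
  by have [t St ht] := qSp_mult (hq i); exists t.
have [t tP] := choice mult.
have pP i : prime_hyperideal (colon (hrad (As i)) (t i)).
  have [St ht] := tP i.
  exact: (colon_hrad_prime hS (hC i)) (qSp_disjoint (hq i)) St ht.
have [x Ax|j AP] := prime_avoidance A _ _ hA pP.
  have [i _ Aix] := hcover x Ax; exists i => //.
  by apply: sub_colon; [apply: hrad_hyperideal|apply: sub_hrad].
exists (t j); first by have [] := tP j.
by exists j => z /hmul_setP [_ [x [-> /AP tx]]]; apply: tx.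
Qed.
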